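(* Let $\mathbb F$ be a field of characteristic $0$, $N\ge1$, and let $B=\mathbb F[u_i^{(n)}\mid i=1,\dots,N,\ n\in\mathbb Z_{\ge0}]$ be the vertex algebra of $N$ free bosons over $\mathbb F$. Then: (1) $\dim\mathrm{Cas}(B)=N+1$, and the classes of $1,u_1,\dots,u_N$ form a basis of $\mathrm{Cas}(B)$; (2) $\dim\big(\mathrm{Der}(B)/\mathrm{Inder}(B)\big)=\binom{N+1}2$, and representatives of a basis are given by the unique derivations of $B$ acting on the generators as $$\frac{\partial}{\partial u_i}\ (1\le i\le N),\qquad D_{ij}=\sum_{n\ge0}\Big(u_i^{(n)}\frac{\partial}{\partial u_j^{(n)}}-u_j^{(n)}\frac{\partial}{\partial u_i^{(n)}}\Big)\ (1\le i<j\le N),$$ i.e. $\frac{\partial}{\partial u_i}$ sends $u_j\mapsto\delta_{ij}1$, and $D_{ij}$ sends $u_j\mapsto u_i$, $u_i\mapsto-u_j$, $u_l\mapsto0$ for $l\ne i,j$.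
   Context: $B$ is the (purely even) vertex algebra over $\mathbb F$ obtained as the quotient by the ideal generated by $K-1$ of the universal enveloping vertex algebra of the Lie conformal algebra $R=\mathbb F[\partial]u_1\oplus\dots\oplus\mathbb F[\partial]u_N\oplus\mathbb FK$ with $[{u_i}_\lambda u_j]=\lambda\delta_{ij}K$, $K$ central, $\partial K=0$. Equivalently, $B$ is the vertex algebra freely generated by $u_1,\dots,u_N$ with $[{u_i}_\lambda u_j]=\delta_{ij}\lambda1$ (the rank $N$ Heisenberg vertex algebra), where $1$ is the vacuum and $u_i^{(n)}=\partial^nu_i$; $[a_\lambda b]=\sum_{n\ge0}\frac{\lambda^n}{n!}a_{(n)}b$ denotes the $\lambda$-bracket and $:\!ab\!:\,=a_{(-1)}b$ the normally ordered product. $\mathrm{Cas}(B)=\{\text{classes of }v\text{ in }B/\partial B\mid[v_\lambda b]|_{\lambda=0}=0\ \text{for all }b\in B\}$. $\mathrm{Der}(B)$ is the space of linear maps $D:B\to B$ commuting with $\partial$ and satisfying $D(:\!ab\!:)=\,:\!D(a)b\!:+:\!aD(b)\!:$ and $D([a_\lambda b])=[D(a)_\lambda b]+[a_\lambda D(b)]$. $\mathrm{Inder}(B)$ is the subspace of the inner derivations $b\mapsto[v_\lambda b]|_{\lambda=0}$, $v\in B$. *)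

(* Defs.v *)
(* Function spaces V -> V get their vector space structure from
   mathcomp-classical. *)
From HB Require Import structures.
From mathcomp Require Import all_boot all_order all_algebra.
From mathcomp Require Import boolp classical_sets functions.

Set Implicit Arguments.
Unset Strict Implicit.
Unset Printing Implicit Defensive.

Import Order.TTheory GRing.Theory Num.Theory.
Local Open Scope classical_set_scope.
Local Open Scope ring_scope.

(* The binomial coefficient n(n-1)...(n-j+1)/j! for an integer n, using
   binom(-(m+1), j) = (-1)^j binom(m+j, j) when n is negative. *)
Definition binz (n : int) (j : nat) : int :=
  match n with
  | Posz m => 'C(m, j)%:Z
  | Negz m => (-1) ^+ j * 'C(m + j, j)%:Z
  end.

(* [nprod a n b] is the n-th product a_(n) b.  By [nprod_locality] both sides of
   Borcherds' identity are finite sums, so that their equality amounts to the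
   equality of all large enough partial sums.  There is no parity: vertex
   algebras are purely even. *)
HB.mixin Record isVertexAlgebra (F : fieldType) V of GRing.Lmodule F V := {
  vac : V;
  nprod : V -> int -> V -> V;
  nprod_linear_r : forall (a : V) (n : int), linear (nprod a n);
  nprod_linear_l : forall (n : int) (b : V), linear (fun a => nprod a n b);
  nprod_locality : forall a b : V, exists K : nat,
    forall n : int, K%:Z <= n -> nprod a n b = 0;
  nprod_vac_l : forall (n : int) (a : V),
    nprod vac n a = if n == -1 then a else 0;
  nprod_vac_r : forall (a : V), nprod a (-1) vac = a;
  nprod_vac_r0 : forall (n : int) (a : V), 0 <= n -> nprod a n vac = 0;
  nprod_borcherds : forall (a b c : V) (m n k : int),
    exists M0 : nat, forall M : nat, (M0 <= M)%N ->
      \sum_(j < M) nprod (nprod a (n + j%:Z) b) (m + k - j%:Z) c *~ binz m j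
      = \sum_(j < M)
          (nprod a (m + n - j%:Z) (nprod b (k + j%:Z) c)
           - nprod b (n + k - j%:Z) (nprod a (m + j%:Z) c)
               *~ (-1) ^+ `|n|%N)
            *~ ((-1) ^+ j * binz n j)
}.

#[short(type="vertexAlgType")]
HB.structure Definition VertexAlgebra (F : fieldType) :=
  {V of isVertexAlgebra F V & GRing.Lmodule F V}.

Section VertexAlgebraNotions.
Variables (F : fieldType) (V : vertexAlgType F).
Implicit Types (a b v : V) (D : V -> V).

(* The translation operator (the derivation of V written \partial). *)
Definition transl (a : V) : V := nprod a (-2) vac.

(* The normally ordered product :ab:. *)
Definition nop (a b : V) : V := nprod a (-1) b.

(* The lambda-bracket [a_lambda b], as its sequence of coefficients:
   [lbracket a b n] is the coefficient a_(n) b / n! of lambda^n; in particular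
   [lbracket a b 0] is the value at lambda = 0. *)
Definition lbracket (a b : V) (n : nat) : V := (n`!%:R : F)^-1 *: nprod a n%:Z b.

(* The subspace \partial V, and the v whose classes in V/\partial V are the
   elements of Cas(V). *)
Definition transl_image : set V := range transl.

Definition casimir_rep : set V := [set v | forall b, lbracket v b 0 = 0].

Definition is_derivation (D : V -> V) : Prop :=
  [/\ linear D,
      forall a, D (transl a) = transl (D a),
      forall a b, D (nop a b) = nop (D a) b + nop a (D b)
    & forall a b n, D (lbracket a b n) = lbracket (D a) b n + lbracket a (D b) n].

Definition Der : set (V -> V) := [set D | is_derivation D].

Definition Inder : set (V -> V) :=
  [set D | exists v, forall b, D b = lbracket v b 0].

End VertexAlgebraNotions.

Arguments transl_image {F} V.
Arguments casimir_rep {F} V.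
Arguments Der {F} V.
Arguments Inder {F} V.

Section QuotientBases.
Variables (F : fieldType) (E : lmodType F).

(* For subspaces W of U of E: the classes of the e i, i in I, form a basis of
   the quotient space U/W.  Finite linear combinations of the e i are sums over
   duplicate-free lists of indices. *)
Definition basis_of_quotient (U W : set E) (I : eqType) (e : I -> E) : Prop :=
  [/\ W `<=` U,
      forall i, U (e i),
      forall (s : seq I) (c : I -> F), uniq s ->
        W (\sum_(i <- s) c i *: e i) -> forall i, i \in s -> c i = 0
    & forall v, U v -> exists (s : seq I) (c : I -> F),
        uniq s /\ W (v - \sum_(i <- s) c i *: e i)].

Definition dim_of_quotient (U W : set E) (d : nat) : Prop :=
  exists e : 'I_d -> E, basis_of_quotient U W e.

Definition is_basis (I : eqType) (e : I -> E) : Prop :=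
  basis_of_quotient [set: E] [set 0] e.

End QuotientBases.

Section FreeBosons.
Variables (F : fieldType) (V : vertexAlgType F) (N : nat) (u : 'I_N -> V).

(* u_i^(n), for the pair p = (i, n). *)
Definition gen (p : 'I_N * nat) : V := iter p.2 (@transl F V) (u p.1).

(* :g_1 g_2 ... g_s: = :g_1 (:g_2 ... (:g_s 1:) ... :):, with value 1 on the
   empty list. *)
Definition nmonomial (s : seq ('I_N * nat)) : V :=
  foldr (fun p b => nop (gen p) b) vac s.

(* The normally ordered monomials in the u_i^(n), with factors weakly increasing
   for the lexicographic order on pairs (i, n), form a basis of V: this
   identifies V with the space of polynomials F[u_i^(n)]. *)
Definition freely_generated : Prop :=
  is_basis (fun s : {s : seq ('I_N *l nat) | sorted <=%O s} =>
    nmonomial (val s)).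

Definition is_free_bosons : Prop :=
  freely_generated /\
  forall i j n, lbracket (u i) (u j) n = if (i == j) && (n == 1%N) then vac else 0.

Definition is_partial (i : 'I_N) (D : V -> V) : Prop :=
  is_derivation D /\ forall j, D (u j) = if j == i then vac else 0.

Definition is_rotation (i j : 'I_N) (D : V -> V) : Prop :=
  [/\ is_derivation D, D (u j) = u i, D (u i) = - u j
    & forall l, l != i -> l != j -> D (u l) = 0].

Definition vac_and_gens (o : option 'I_N) : V :=
  if o is Some i then u i else vac.

Definition outer_family (P : 'I_N -> V -> V) (R : 'I_N -> 'I_N -> V -> V)
    (x : 'I_N + {p : 'I_N * 'I_N | (p.1 < p.2)%N}) : V -> V :=
  match x with
  | inl i => P i
  | inr p => R (val p).1 (val p).2
  end.

End FreeBosons.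

(* Main.v *)
(* Write E for the degree operator sum_i sum_(n > 0) u_i(-n) u_i(n) / n.  Skew
   symmetry gives v_(0) u_i = d S_i v, where S_i is the variational derivative,
   and E v = sum_i :u_i (S_i v): modulo dB.  As ker d = F1, a v in Cas(B) has
   E v in W = span(1, u_1, ..., u_N) + dB, and the polynomial (E-1)...(E-n) then
   reduces v itself into W.

   If D is a derivation and f_i = D u_i, then f_i(n) u_j + u_i(n) f_j = 0 for
   n >= 0; since u_i(0) = 0, each f_i lies in Cas(B), so
   f_i = c_i 1 + sum_j a_ij u_j + d g_i with a skew.  The c_i and a_ij are removed
   by the derivations u_i(1) and by rotations.  If f_i = d g_i for all i, then
   v = sum_j :u_j g_j: satisfies v_(0) u_i = (1 + E) f_i; the same descent on E
   shows that f is inner.  Of the freeness of B, only the spanning property of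
   monomials and 1 <> 0 are used. *)
Require Import Defs.
From HB Require Import structures.
From mathcomp Require Import all_boot all_order all_algebra.
From mathcomp Require Import zify.
From mathcomp Require Import boolp classical_sets functions.
Import Order.TTheory GRing.Theory Num.Theory.
Local Open Scope ring_scope.

(** * Identities between truncated sums *)

Section Eventually.

(** Sums that are finite by locality appear as truncations at [M]. Working with all large [M] lets
    several identities share one truncation and be compared term by term. *)
Definition eventually (P : nat -> Prop) : Prop :=
  exists M0 : nat, forall M : nat, (M0 <= M)%N -> P M.

Lemma eventually_ge (n : nat) : eventually (fun M => n <= M)%N.
Proof. by exists n. Qed.

Lemma eventually_and {P Q : nat -> Prop} :
  eventually P -> eventually Q -> eventually (fun M => P M /\ Q M).
Proof.
move=> [a Pa] [b Qb]; exists (maxn a b) => M; rewrite geq_max => /andP[aM bM].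
by split; [exact: Pa | exact: Qb].
Qed.

Lemma eventually_ex {P : nat -> Prop} : eventually P -> exists M, P M.
Proof. by move=> [a Pa]; exists a; exact: Pa. Qed.

Lemma eventually_forall {T : finType} {P : T -> nat -> Prop} :
  (forall i, eventually (P i)) -> eventually (fun M => forall i, P i M).
Proof.
move=> /choice[f Pf]; exists (\max_i f i)%N => M fM i.
by apply: Pf; apply: leq_trans fM; exact: leq_bigmax.
Qed.

Lemma big_ord_only {M : zmodType} {n : nat} (j0 : nat) (f : nat -> M) :
  (j0 < n)%N -> (forall j, j != j0 -> f j = 0) -> \sum_(j < n) f j = f j0.
Proof.
move=> lt_j0 f0; rewrite (bigD1 (Ordinal lt_j0)) //= big1 ?addr0 // => j.
by rewrite -val_eqE /= => /f0.
Qed.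

End Eventually.

(** * Consequences of Borcherds' identity in a general vertex algebra *)

Section VertexAlgebra.
Set Implicit Arguments.
Unset Strict Implicit.
Variables (F : fieldType) (V : vertexAlgType F).
Implicit Types (a b c v w : V) (m n k : int) (D : V -> V).

Notation "a _( n ) b" := (nprod a n b)
  (at level 30, n at level 99, b at level 30, format "a  _( n )  b").
Notation vac := (vac : V).

HB.instance Definition _ a n :=
  GRing.isLinear.Build F V V *:%R (nprod a n) (nprod_linear_r a n).

Definition nprodl n b a : V := a _(n) b.

HB.instance Definition _ n b :=
  GRing.isLinear.Build F V V *:%R (nprodl n b) (nprod_linear_l n b).

HB.instance Definition _ :=
  GRing.isLinear.Build F V V *:%R (@transl F V)
    (nprod_linear_l (-2) (@Defs.vac F V)).

Definition bundle_linear D (Dlin : linear D) : {linear V -> V} :=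
  HB.pack D (GRing.isLinear.Build F V V *:%R D Dlin).

Lemma linear_map0 D : linear D -> D 0 = 0.
Proof. by move=> Dlin; exact: (raddf0 (bundle_linear Dlin)). Qed.

Lemma linear_mapB D : linear D -> forall a b, D (a - b) = D a - D b.
Proof. by move=> Dlin; exact: (raddfB (bundle_linear Dlin)). Qed.

Lemma linear_mapZ D : linear D -> forall (x : F) a, D (x *: a) = x *: D a.
Proof. by move=> Dlin x a; exact: (linearZ_LR (bundle_linear Dlin)). Qed.

Lemma linear_mapMz D : linear D -> forall a (z : int), D (a *~ z) = D a *~ z.
Proof. by move=> Dlin a z; exact: (raddfMz (bundle_linear Dlin)). Qed.

Lemma linear_map_sum D : linear D ->
  forall (I : Type) (r : seq I) (P : pred I) (f : I -> V),
  D (\sum_(i <- r | P i) f i) = \sum_(i <- r | P i) D (f i).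
Proof. by move=> Dlin I r P f; exact: (raddf_sum (bundle_linear Dlin)). Qed.

Lemma nprod0l n b : 0 _(n) b = 0.
Proof. exact: (raddf0 (nprodl n b)). Qed.

Lemma nprodDl n a1 a2 b : (a1 + a2) _(n) b = a1 _(n) b + a2 _(n) b.
Proof. exact: (raddfD (nprodl n b)). Qed.

Lemma nprodBl n a1 a2 b : (a1 - a2) _(n) b = a1 _(n) b - a2 _(n) b.
Proof. exact: (raddfB (nprodl n b)). Qed.

Lemma nprodZl n (x : F) a b : (x *: a) _(n) b = x *: (a _(n) b).
Proof. exact: (linearZ_LR (nprodl n b)). Qed.

Lemma nprod_suml n b (I : Type) (r : seq I) (P : pred I) (f : I -> V) :
  (\sum_(i <- r | P i) f i) _(n) b = \sum_(i <- r | P i) (f i) _(n) b.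
Proof. exact: (raddf_sum (nprodl n b)). Qed.

Lemma nprodZr n (x : F) a b : a _(n) (x *: b) = x *: (a _(n) b).
Proof. exact: (linearZ_LR (nprod a n)). Qed.

Lemma translB a b : transl (a - b) = transl a - transl b.
Proof. exact: (raddfB (@transl F V)). Qed.

Lemma translZ (x : F) a : transl (x *: a) = x *: transl a.
Proof. exact: (linearZ_LR (@transl F V)). Qed.

Lemma binz0n (j : nat) : binz 0 j = (j == 0)%N%:Z.
Proof. exact: (congr1 Posz (bin0n j)). Qed.

(** Borcherds' identity at [n = 0], where [binz 0 j] leaves only [j = 0] on the right. *)
Lemma nprod_commutator a b c m k :
  eventually (fun M => a _(m) (b _(k) c) - b _(k) (a _(m) c)
    = \sum_(j < M) ((a _(j%:Z) b) _(m + k - j%:Z) c) *~ binz m j).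
Proof.
have [M0 H] := nprod_borcherds a b c m 0 k; exists M0.+1 => M ltM.
have {}H := H M (ltnW ltM).
rewrite (eq_bigr (fun j : 'I_M => ((a _(0 + j%:Z) b) _(m + k - j%:Z) c) *~ binz m j));
  last by move=> j _; rewrite add0r.
rewrite H (big_ord_only 0 (fun j => (a _(m + 0 - j%:Z) (b _(k + j%:Z) c) -
  b _(0 + k - j%:Z) (a _(m + j%:Z) c) *~ (-1) ^+ `|0|%N) *~ ((-1) ^+ j * binz 0 j))).
- rewrite absz0 !expr0 /= !mulr1z.
  by congr (nprod _ _ (nprod _ _ _) - nprod _ _ (nprod _ _ _)); lia.
- by apply: leq_trans ltM.
- by move=> [|j] // _; rewrite binz0n mulr0 mulr0z.
Qed.

(** Borcherds' identity at [m = 0], where the left side collapses to [j = 0]. *)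
Lemma nprod_assoc a b c n k :
  eventually (fun M => (a _(n) b) _(k) c
    = \sum_(j < M) (a _(n - j%:Z) (b _(k + j%:Z) c)
        - b _(n + k - j%:Z) (a _(j%:Z) c) *~ (-1) ^+ `|n|%N)
          *~ ((-1) ^+ j * binz n j)).
Proof.
have [M0 H] := nprod_borcherds a b c 0 n k; exists M0.+1 => M ltM.
have {}H := H M (ltnW ltM).
rewrite [RHS](eq_bigr (fun j : 'I_M => (a _(0 + n - j%:Z) (b _(k + j%:Z) c) -
  b _(n + k - j%:Z) (a _(0 + j%:Z) c) *~ (-1) ^+ `|n|%N) *~ ((-1) ^+ j * binz n j)));
  last by move=> j _; rewrite !add0r.
rewrite -H (big_ord_only 0 (fun j => ((a _(n + j%:Z) b) _(0 + k - j%:Z) c) *~ binz 0 j)).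
- by rewrite mulr1z; congr (nprod (nprod _ _ _) _ _); lia.
- by apply: leq_trans ltM.
- by move=> [|j] // _; rewrite binz0n mulr0z.
Qed.

Lemma nprod_vac_neq n a : n != -1 -> vac _(n) a = 0.
Proof. by move=> /negbTE n1; rewrite nprod_vac_l n1. Qed.

Lemma nprod_vacN1 a : vac _(-1) a = a.
Proof. by rewrite nprod_vac_l. Qed.

Lemma transl_vac : transl vac = 0.
Proof. by rewrite /transl nprod_vac_neq. Qed.

(** Associativity with the vacuum in the middle. Only the mode [-1] of the vacuum is nonzero, so at
    most one index survives: [j = -k - 1] in the first product if [k < 0], [j = k - 1] in the second
    if [k > 0], none if [k = 0]. *)
Lemma nprod_transl_l a k c : (transl a) _(k) c = - (a _(k - 1) c *~ k).
Proof.
have [M [H ltM]] := eventually_ex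
  (eventually_and (nprod_assoc a vac c (-2) k) (eventually_ge `|k|.+2)).
rewrite /transl H {H}.
have [k0|k0] := leP 0 k; last first.
  have [j kj] : exists j : nat, k = - (j.+1%:Z) by exists `|k|.-1; lia.
  rewrite (big_ord_only j (fun j => (a _(-2 - j%:Z) (vac _(k + j%:Z) c)
        - vac _(-2 + k - j%:Z) (a _(j%:Z) c) *~ (-1) ^+ `|(-2)%R|%N)
          *~ ((-1) ^+ j * binz (-2) j))).
  - rewrite [X in _ - X]nprod_vac_neq; last by lia.
    rewrite subr0 kj.
    rewrite (_ : - j.+1%:Z + j%:Z = -1); last by lia.
    rewrite nprod_vacN1 (_ : -2 - j%:Z = - j.+1%:Z - 1); last by lia.
    by rewrite /binz /= mulrA -exprMn mulrNN mulr1 expr1n mul1r add1n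
      -bin_sub // subSnn bin1 mulrNz opprK.
  - by lia.
  - move=> i ij; rewrite nprod_vac_neq; last by lia.
    rewrite linear0 nprod_vac_neq; last by lia.
    by rewrite mul0rz subr0 mul0rz.
have [k1|k1] := leP k 0.
  have -> : k = 0 by lia.
  rewrite mulr0z oppr0 big1 // => i _.
  rewrite nprod_vac_neq; last by lia.
  rewrite linear0 nprod_vac_neq; last by lia.
  by rewrite mul0rz subr0 mul0rz.
have [j kj] : exists j : nat, k = j.+1%:Z by exists `|k|.-1; lia.
rewrite (big_ord_only j (fun j => (a _(-2 - j%:Z) (vac _(k + j%:Z) c)
      - vac _(-2 + k - j%:Z) (a _(j%:Z) c) *~ (-1) ^+ `|(-2)%R|%N)
        *~ ((-1) ^+ j * binz (-2) j))).
- rewrite nprod_vac_neq; last by lia.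
  rewrite linear0 sub0r kj.
  rewrite (_ : -2 + j.+1%:Z - j%:Z = -1); last by lia.
  rewrite nprod_vacN1 (_ : j.+1%:Z - 1 = j%:Z); last by lia.
  by rewrite /binz /= mulrA -exprMn mulrNN mulr1 expr1n mul1r add1n
    -bin_sub // subSnn bin1 mulr1z mulNrz.
- by lia.
- move=> i ij; rewrite nprod_vac_neq; last by lia.
  rewrite linear0 nprod_vac_neq; last by lia.
  by rewrite mul0rz subr0 mul0rz.
Qed.

Lemma nprod_vac_nneg a (j : nat) : a _(j%:Z) vac = 0.
Proof. exact: nprod_vac_r0. Qed.

(** Associativity applied to the vacuum with outer index [-2]: the modes [-2 + j] with [j >= 2] kill
    the vacuum, which leaves [j = 0] and [j = 1]. *)
Lemma transl_nprod a n b :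
  transl (a _(n) b) = a _(n) (transl b) - a _(n - 1) b *~ n.
Proof.
have [M [H ltM]] := eventually_ex
  (eventually_and (nprod_assoc a b vac n (-2)) (eventually_ge 2)).
rewrite /transl H {H}; case: M ltM => [|[|M]] // _.
rewrite !big_ord_recl big1 => [|i _].
  rewrite /= !nprod_vac_nneg !linear0 !mul0rz !subr0 addr0.
  rewrite (_ : bump 0 0 = 1%N) // (_ : -2 + 1%:Z = -1) // nprod_vac_r.
  have -> : (-1) ^+ 0 * binz n 0 = 1.
    by case: n => n; rewrite /binz ?bin0 expr0 mul1r.
  have -> : (-1) ^+ 1 * binz n 1 = - n.
    by case: n => n; rewrite expr1 /binz bin1; lia.
  by rewrite mulr1z mulrNz.
rewrite nprod_vac_nneg (nprod_vac_r0 (-2 + _)); last by rewrite /= /bump; lia.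
by rewrite !linear0 mul0rz subr0 mul0rz.
Qed.

(* The divided power x |-> d^j x / j! of the translation operator. *)
Definition dpow (j : nat) (x : V) : V := x _(-1 - j%:Z) vac.

HB.instance Definition _ j :=
  GRing.isLinear.Build F V V *:%R (dpow j) (nprod_linear_l (-1 - j%:Z) vac).

Lemma dpow0 x : dpow 0 x = x.
Proof. by rewrite /dpow subr0 nprod_vac_r. Qed.

Lemma transl_dpow j x : transl (dpow j x) = dpow j.+1 x *+ j.+1.
Proof.
rewrite /dpow transl_nprod transl_vac linear0 sub0r.
rewrite (_ : -1 - j%:Z - 1 = -1 - j.+1%:Z); last by lia.
by rewrite (_ : -1 - j%:Z = - j.+1%:Z) ?mulrNz ?opprK //; lia.
Qed.

Lemma dpow_transl j x : dpow j (transl x) = dpow j.+1 x *+ j.+1.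
Proof.
rewrite /dpow nprod_transl_l.
rewrite (_ : -1 - j%:Z - 1 = -1 - j.+1%:Z); last by lia.
by rewrite (_ : -1 - j%:Z = - j.+1%:Z) ?mulrNz ?opprK //; lia.
Qed.

(** Borcherds' identity at [m = -1], [n = k = 0], applied to the vacuum; the signs are
    [binz (-1) j]. *)
Lemma nprod_skew a b : eventually (fun M => 
  b _(0) a = - \sum_(j < M) (-1) ^+ j *: dpow j (a _(j%:Z) b)).
Proof.
have [M0 H] := nprod_borcherds a b vac (-1) 0 0; exists M0.+1 => M ltM.
have {}H := H M (ltnW ltM).
have binN1 j : binz (-1) j = (-1) ^+ j by rewrite /binz /= add0n binn mulr1.
rewrite (eq_bigr (fun j : 'I_M => ((a _(0 + j%:Z) b) _(-1 + 0 - j%:Z) vac)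
    *~ binz (-1) j)); last first.
  move=> j _; rewrite binN1 add0r addr0 /dpow -scaler_int.
  by rewrite rmorphXn rmorphN1.
rewrite H (big_ord_only 0 (fun j => (a _(-1 + 0 - j%:Z) (b _(0 + j%:Z) vac) -
  b _(0 + 0 - j%:Z) (a _(-1 + j%:Z) vac) *~ (-1) ^+ `|0|%N) *~ ((-1) ^+ j * binz 0 j))).
- rewrite nprod_vac_nneg linear0 sub0r mulNrz opprK absz0 !mulr1z.
  by rewrite (_ : -1 + 0%:Z = -1) // nprod_vac_r.
- by apply: leq_trans ltM.
- by move=> [|j] // _; rewrite binz0n mulr0 mulr0z.
Qed.

Lemma lbracket0 v b : lbracket v b 0 = v _(0) b.
Proof. by rewrite /lbracket fact0 invr1 scale1r. Qed.

Definition is_nprod_derivation D : Prop :=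
  linear D /\ forall n a b, D (a _(n) b) = (D a) _(n) b + a _(n) (D b).

Lemma nprod_derivation_vac D : is_nprod_derivation D -> D vac = 0.
Proof.
case=> _ DM; have := DM (-1) vac vac; rewrite nprod_vacN1 nprod_vac_r nprod_vacN1.
by move/eqP; rewrite -subr_eq0 opprD addrA subrr sub0r oppr_eq0 => /eqP.
Qed.

Lemma nprod_derivation_is_derivation D : is_nprod_derivation D -> is_derivation D.
Proof.
move=> DD; have [Dlin DM] := DD; split=> //.
- by move=> a; rewrite /transl DM (nprod_derivation_vac DD) linear0 addr0.
- by move=> a b; rewrite /nop DM.
- by move=> a b n; rewrite /lbracket -scalerDr -DM linear_mapZ.
Qed.

Lemma nprod0_derivation v : is_nprod_derivation (nprod v 0).
Proof.
split=> [|n a b]; first exact: nprod_linear_r.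
have [M [H ltM]] := eventually_ex
  (eventually_and (nprod_commutator v a b 0 n) (eventually_ge 1)).
move/eqP: H; rewrite subr_eq => /eqP ->.
rewrite (big_ord_only 0 (fun j => ((v _(j%:Z) a) _(0 + n - j%:Z) b) *~ binz 0 j)) //.
  by rewrite add0r subr0.
by move=> [|j] // _; rewrite binz0n mulr0z.
Qed.

(** The commutator of [v _(1)] with a mode of [a] has two terms, and the one containing [v _(0) a]
    vanishes. For [v = u i] this yields the partial derivatives. *)
Lemma nprod1_derivation v : (forall b, v _(0) b = 0) ->
  is_nprod_derivation (nprod v 1).
Proof.
move=> v0; split=> [|n a b]; first exact: nprod_linear_r.
have [M [H ltM]] := eventually_ex
  (eventually_and (nprod_commutator v a b 1 n) (eventually_ge 2)).
move/eqP: H; rewrite subr_eq => /eqP ->.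
rewrite (big_ord_only 1 (fun j => ((v _(j%:Z) a) _(1 + n - j%:Z) b) *~ binz 1 j)) //.
  by rewrite addrAC subrr add0r.
by move=> [|[|j]] // _; rewrite v0 nprod0l mul0rz.
Qed.

End VertexAlgebra.

(** * Bases of quotients indexed by finite types *)

Section FiniteBases.
Set Implicit Arguments.
Unset Strict Implicit.
Variables (F : fieldType) (E : lmodType F).

Lemma basis_of_quotient_fin (U W : set E) (I : finType) (e : I -> E) :
  (W `<=` U)%classic -> (forall i, U (e i)) ->
  (forall c : I -> F, W (\sum_i c i *: e i) -> forall i, c i = 0) ->
  (forall v, U v -> exists c : I -> F, W (v - \sum_i c i *: e i)) ->
  basis_of_quotient U W e.
Proof.
move=> WU Ue free span; split=> // [s c uniq_s Ws i i_s|v /span[c Wc]].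
  (* The coefficients are extended by zero outside the list. *)
  have := free (fun j => if j \in s then c j else 0) _ i; rewrite i_s; apply.
  rewrite big_uniq // big_mkcond /= in Ws.
  rewrite (eq_bigr (fun j => if j \in s then c j *: e j else 0)) // => j _.
  by case: ifP => // _; rewrite scale0r.
by exists (enum I), c; rewrite enum_uniq big_enum.
Qed.

Lemma dim_of_quotient_fin (U W : set E) (I : finType) (e : I -> E) :
  basis_of_quotient U W e -> dim_of_quotient U W #|I|.
Proof.
case=> WU Ue free span; exists (fun i => e (enum_val i)); split=> //.
  move=> s c uniq_s Ws i i_s.
  rewrite -[i]enum_valK; apply: (free (map enum_val s) (c \o enum_rank)).
  - by rewrite map_inj_uniq //; exact: enum_val_inj.
  - by rewrite big_map; under eq_bigr => j _ do rewrite /= enum_valK.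
  - exact: map_f.
move=> v /span[s [c [uniq_s Ws]]].
exists (map enum_rank s), (c \o enum_val); split.
  by rewrite map_inj_uniq //; exact: enum_rank_inj.
by rewrite big_map; under eq_bigr => j _ do rewrite /= enum_rankK.
Qed.

End FiniteBases.

(** Grouping the pairs by their larger entry [j] gives the sum of all [j < n]. *)
Lemma card_ltn_pairs (n : nat) :
  #|{: {p : 'I_n * 'I_n | (p.1 < p.2)%N}}| = 'C(n, 2).
Proof.
rewrite card_sig -sum1_card.
rewrite -(pair_big_dep xpredT (fun i j : 'I_n => (i < j)%N) (fun _ _ => 1%N)) /=.
rewrite (exchange_big_dep xpredT) //= -bin2_sum big_mkord.
apply: eq_bigr => j _; rewrite -(big_ord_widen n (fun=> 1%N)) ?sum1_card ?card_ord //.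
exact: ltnW.
Qed.

Lemma sub4_regroup (M : zmodType) (p q x y z t : M) :
  p + x - y + (- (q + z) - - t) = x + t - (z + y) + (p - q).
Proof.
by rewrite !opprD opprK !addrA [LHS](ACl (2*6*5*3*1*4)).
Qed.

Lemma sub3_regroup (M : zmodType) (p q r x y z : M) :
  p + (q + r) - (y + (x + z)) = (p - x) + (q - y) + (r - z).
Proof. by rewrite (addrCA y) opprD (addrACA p) opprD (addrACA q) addrA. Qed.

(** * Modes of the free bosons and the Heisenberg relations *)

Section FreeBosons.
Set Implicit Arguments.
Unset Strict Implicit.
Variables (F : fieldType) (charF0 : [pchar F] =i pred0).
Variables (V : vertexAlgType F) (N : nat) (u : 'I_N -> V).
Hypothesis uB : is_free_bosons u.
Implicit Types (a b c v w : V) (m : int) (n : nat) (D : V -> V) (i j k : 'I_N).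

Notation "a _( n ) b" := (nprod a n b)
  (at level 30, n at level 99, b at level 30, format "a  _( n )  b").
Notation vac := (vac : V).

Lemma natS_neq0 (n : nat) : n.+1%:R != 0 :> F.
Proof. by move/pcharf0P: charF0 => ->. Qed.

Lemma fact_neq0 (n : nat) : n`!%:R != 0 :> F.
Proof. by move/pcharf0P: charF0 => ->; rewrite -lt0n fact_gt0. Qed.

Lemma vac_neq0 : vac != 0.
Proof.
have [[_ _ free _] _] := uB; apply/eqP => vac0.
pose s0 : {s : seq ('I_N *l nat) | sorted <=%O s} := exist _ [::] isT.
suff /eqP : (1 : F) = 0 by rewrite oner_eq0.
apply: (free [:: s0] (fun=> 1) isT _ s0 (mem_head _ _)).
by rewrite big_seq1 /= vac0 scaler0.
Qed.

Lemma gen_bracket i j (n : nat) :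
  u i _(n%:Z) u j = if (i == j) && (n == 1)%N then vac else 0.
Proof.
have [_ /(_ i j n)] := uB; rewrite /lbracket => H.
have -> : u i _(n%:Z) u j
    = n`!%:R *: (if (i == j) && (n == 1)%N then vac else 0).
  by rewrite -H scalerA mulfV ?scale1r // fact_neq0.
by case: ifP => [/andP[_ /eqP->]|]; rewrite ?scale1r ?scaler0.
Qed.

(** Each translation lowers the mode index by one up to a scalar, so monomials are built from
    creation modes of the generators alone. *)
Lemma iter_transl_nprod a b (n q : nat) : exists x : F,
  (iter n (@transl F V) a) _(-1 - q%:Z) b = x *: (a _(-1 - (q + n)%N%:Z) b).
Proof.
elim: n q => [|n IHn] q; first by exists 1; rewrite scale1r addn0.
have [x xP] := IHn q.+1.
exists (q.+1%:R * x); rewrite /= nprod_transl_l.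
rewrite (_ : -1 - q%:Z - 1 = -1 - q.+1%:Z); last by lia.
rewrite xP addSnnS (_ : -1 - q%:Z = - q.+1%:Z); last by lia.
by rewrite mulrNz opprK -scalerA scaler_nat.
Qed.

Lemma monomial_ind (Q : V -> Prop) :
  (forall (x : F) a b, Q a -> Q b -> Q (x *: a + b)) ->
  (forall s, Q (nmonomial u s)) -> forall v, Q v.
Proof.
move=> Qlin Qmon v; have [[_ _ _ span] _] := uB.
have [s [c [_]]] := span v I.
move=> /= /eqP; rewrite subr_eq0 => /eqP ->.
elim: s => [|p s IHs]; last by rewrite big_cons; exact: Qlin.
rewrite big_nil -(addNr vac) -scaleN1r.
by apply: Qlin; exact: (Qmon [::]).
Qed.

Lemma nmonomial_cons p s : exists x : F,
  nmonomial u (p :: s) = x *: (u p.1 _(-1 - p.2%:Z) (nmonomial u s)).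
Proof.
have [x xP] := iter_transl_nprod (u p.1) (nmonomial u s) p.2 0.
by exists x; rewrite /= /nop /gen (_ : -1 = -1 - 0%:Z).
Qed.

(** Spanning by monomials becomes an induction over creation modes, so that an operator is
    controlled by its commutators with modes of generators. *)
Lemma creation_ind (Q : V -> Prop) : Q vac ->
  (forall (x : F) a b, Q a -> Q b -> Q (x *: a + b)) ->
  (forall i (n : nat) b, Q b -> Q (u i _(-1 - n%:Z) b)) -> forall v, Q v.
Proof.
move=> Q1 Qlin Qmode; apply: monomial_ind => //.
elim=> [//|p s IHs]; have [x ->] := nmonomial_cons p s.
have Q0 : Q 0 by have := Qlin (-1) _ _ Q1 Q1; rewrite scaleN1r addNr.
by rewrite -[_ *: _]addr0; apply: Qlin => //; exact: Qmode.
Qed.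

(** The Heisenberg relations: only index [1] contributes to the commutator formula, since the other
    nonnegative products of generators vanish. *)
Lemma mode_comm i j m (k : int) b : u i _(m) (u j _(k) b)
  = u j _(k) (u i _(m) b) + (if (i == j) && (m + k == 0) then b *~ m else 0).
Proof.
have [M [H ltM]] := eventually_ex
  (eventually_and (nprod_commutator (u i) (u j) b m k) (eventually_ge 2)).
move/eqP: H; rewrite subr_eq => /eqP ->; rewrite addrC; congr (_ + _).
rewrite (big_ord_only 1 (fun l => ((u i _(l%:Z) u j) _(m + k - l%:Z) b) *~ binz m l)) //.
  rewrite gen_bracket eqxx andbT; case: eqP => [_|]; last by rewrite nprod0l mul0rz.
  have -> : binz m 1 = m by case: m => m; rewrite /binz ?expr1 bin1 //; lia.
  rewrite nprod_vac_l (_ : (m + k - 1%:Z == -1) = (m + k == 0)); last by lia.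
  by case: eqP; rewrite // mul0rz.
by move=> l /negbTE l1; rewrite gen_bracket l1 andbF nprod0l mul0rz.
Qed.

(** The mode [u i _(0)] commutes with all modes of generators and kills the vacuum. *)
Lemma mode0 i b : u i _(0) b = 0.
Proof.
elim/creation_ind: b => [|x a b a0 b0|j n b b0].
- by rewrite nprod_vac_r0.
- by rewrite nprod_linear_r a0 b0 scaler0 addr0.
- by rewrite mode_comm b0 linear0 add0r mulr0z if_same.
Qed.

(** Associativity expresses the modes of [u i _(-1 - q) a] through those of [u i] and [a], so the
    Leibniz rule propagates along [creation_ind] in the left factor. *)
Lemma mode_derivation D : linear D -> D vac = 0 ->
  (forall i m b, D (u i _(m) b) = (D (u i)) _(m) b + u i _(m) (D b)) ->
  is_nprod_derivation D.
Proof.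
move=> Dlin D1 Dmode; split=> // n a b.
elim/creation_ind: a n b => [|x a1 a2 IH1 IH2|i q a IH] n b.
- by rewrite D1 nprod0l add0r !nprod_vac_l; case: eqP => // _; exact: linear_map0.
- rewrite nprodDl nprodZl Dlin IH1 IH2 Dlin !nprodDl !nprodZl scalerDr.
  by rewrite addrACA.
rewrite Dmode nprodDl.
have [M [[[H1 H2] H3] H4]] := eventually_ex (eventually_and (eventually_and (eventually_and
  (nprod_assoc (u i) a b (-1 - q%:Z) n)
  (nprod_assoc (D (u i)) a b (-1 - q%:Z) n))
  (nprod_assoc (u i) (D a) b (-1 - q%:Z) n))
  (nprod_assoc (u i) a (D b) (-1 - q%:Z) n)).
rewrite H1 H2 H3 H4 -!big_split /= (linear_map_sum Dlin).
apply: eq_bigr => j _; rewrite -!mulrzDl (linear_mapMz Dlin); congr (_ *~ _).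
rewrite (linear_mapB Dlin) (linear_mapMz Dlin) /= Dmode !IH Dmode !linearD /= !mulrzDl.
exact: sub3_regroup.
Qed.

(** * Quadratic operators in the modes: degree and rotations *)

Definition pair_sum (M : nat) i j b : V :=
  \sum_(l < M) (l.+1%:R : F)^-1 *: (u i _(-1 - l%:Z) (u j _(l.+1%:Z) b)).

(* The locally finite sum of the u_i(-n) u_j(n) / n over n > 0: in polynomial
   terms, the substitution sum_n u_i^(n) d/du_j^(n). *)
Definition Eij i j b : V := pair_sum (sval (cid (nprod_locality (u j) b))) i j b.

Lemma EijE i j b : eventually (fun M => Eij i j b = pair_sum M i j b).
Proof.
rewrite /Eij; case: cid => K /= HK; exists K => M leKM.
rewrite /pair_sum (big_ord_widen M (fun l => (l.+1%:R : F)^-1 *: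
  (u i _(-1 - l%:Z) (u j _(l.+1%:Z) b)))) // [RHS](bigID (fun l : 'I_M => l < K)%N) /=.
rewrite [X in _ + X]big1 ?addr0 // => l; rewrite -leqNgt => leKl.
by rewrite HK ?linear0 ?scaler0 // lez_nat leqW.
Qed.

Lemma Eij_linear i j : linear (Eij i j).
Proof.
move=> x a b.
have [M [[H1 H2] H3]] := eventually_ex (eventually_and (eventually_and
  (EijE i j a) (EijE i j b)) (EijE i j (x *: a + b))).
rewrite H1 H2 H3 /pair_sum scaler_sumr -big_split /=; apply: eq_bigr => l _.
by rewrite !nprod_linear_r scalerDr !scalerA mulrC.
Qed.

Lemma Eij_vac i j : Eij i j vac = 0.
Proof.
have [M ->] := eventually_ex (EijE i j vac).
by rewrite /pair_sum big1 // => l _; rewrite nprod_vac_nneg linear0 scaler0.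
Qed.

Lemma Eij_mode i j k m b : Eij i j (u k _(m) b) =
  u k _(m) (Eij i j b) + (if (j == k) && (m < 0) then u i _(m) b else 0)
  - (if (i == k) && (0 < m) then u j _(m) b else 0).
Proof.
have [M [[-> ->] ltM]] := eventually_ex (eventually_and (eventually_and
  (EijE i j (u k _(m) b)) (EijE i j b)) (eventually_ge `|m|.+1)).
(* [X] and [Y] are the contractions of [u k _(m)] with the annihilation and the creation factor.
   Each can be nonzero only at [l = |m| - 1], where [1 / (l + 1)] cancels the central term up to
   sign. *)
pose X (l : nat) := if (j == k) && (l.+1%:Z + m == 0) then u i _(m) b else 0.
pose Y (l : nat) := if (i == k) && (m == l.+1%:Z) then u j _(m) b else 0.
have -> : (if (j == k) && (m < 0) then u i _(m) b else 0) = \sum_(l < M) X l.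
  rewrite /X; case: (j == k); last by rewrite big1.
  have [m0|m0] /= := ltP m 0; last by rewrite big1 // => l _; case: eqP => //; lia.
  rewrite (big_ord_only `|m|.-1 (fun l => if l.+1%:Z + m == 0 then u i _(m) b else 0)).
  - by case: eqP => //; lia.
  - by lia.
  - by move=> l ?; case: eqP => //; lia.
have -> : (if (i == k) && (0 < m) then u j _(m) b else 0) = \sum_(l < M) Y l.
  rewrite /Y; case: (i == k); last by rewrite big1.
  have [m0|m0] /= := ltP 0 m; last by rewrite big1 // => l _; case: eqP => //; lia.
  rewrite (big_ord_only `|m|.-1 (fun l => if m == l.+1%:Z then u j _(m) b else 0)).
  - by case: eqP => //; lia.
  - by lia.
  - by move=> l ?; case: eqP => //; lia.
rewrite /pair_sum linear_sum -big_split -sumrB /=; apply: eq_bigr => l _.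
rewrite (mode_comm j k) linearD /= (mode_comm i k) !scalerDr linearZ_LR /=.
rewrite -[LHS]addrA -[RHS]addrA; congr (_ + _).
rewrite addrC; congr (_ + _).
  rewrite /X; case: ifP => [/andP[_ /eqP lm]|_]; last by rewrite linear0 scaler0.
  rewrite raddfMz /= (_ : -1 - l%:Z = m); last by lia.
  by rewrite -pmulrn -scaler_nat scalerA mulVf ?natS_neq0 // scale1r.
rewrite /Y (_ : (-1 - l%:Z + m == 0) = (m == l.+1%:Z)); last by lia.
case: ifP => [/andP[_ /eqP ->]|_]; last by rewrite scaler0 oppr0.
rewrite (_ : -1 - l%:Z = - l.+1%:Z); last by lia.
by rewrite mulrNz scalerN -pmulrn -scaler_nat scalerA mulVf ?natS_neq0 // scale1r.
Qed.

(* The degree operator: it counts the factors of a monomial. *)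
Definition Ediag b : V := \sum_i Eij i i b.

Lemma Ediag_linear : linear Ediag.
Proof.
move=> x a b; rewrite /Ediag scaler_sumr -big_split /=.
by apply: eq_bigr => i _; exact: Eij_linear.
Qed.

Lemma Ediag_vac : Ediag vac = 0.
Proof. by rewrite /Ediag big1 // => i _; rewrite Eij_vac. Qed.

Lemma Ediag_creation i (n : nat) b :
  Ediag (u i _(-1 - n%:Z) b) = u i _(-1 - n%:Z) (Ediag b) + u i _(-1 - n%:Z) b.
Proof.
rewrite /Ediag linear_sum [X in _ = _ + X](_ : _ = \sum_k if k == i then u i _(-1 - n%:Z) b else 0).
  rewrite -big_split /=; apply: eq_bigr => k _; rewrite Eij_mode.
  rewrite (_ : -1 - n%:Z < 0) ?andbT; last by lia.
  rewrite (_ : 0 < -1 - n%:Z = false) ?andbF ?subr0; last by lia.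
  by case: eqP => [->|].
by rewrite -big_mkcond big_pred1_eq.
Qed.

Lemma gen_creation i : u i = u i _(-1 - 0%:Z) vac.
Proof. by rewrite (_ : -1 - 0%:Z = -1) // nprod_vac_r. Qed.

Lemma Eij_gen i j k : Eij i j (u k) = if j == k then u i else 0.
Proof.
rewrite gen_creation Eij_mode Eij_vac linear0 add0r /= !andbT andbF subr0.
by rewrite -gen_creation.
Qed.

Definition rot i j b : V := Eij i j b - Eij j i b.

Lemma rot_gen i j k :
  rot i j (u k) = (if j == k then u i else 0) - (if i == k then u j else 0).
Proof. by rewrite /rot !Eij_gen. Qed.

(** [Eij i j] acts by [u j -> u i] on creation modes and by [u i -> - u j] on annihilation modes.
    Skew-symmetrizing makes the two actions agree, which is the Leibniz rule for modes. *)
Lemma rot_derivation i j : is_nprod_derivation (rot i j).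
Proof.
have rot_lin : linear (rot i j).
  by move=> x a b; rewrite /rot !Eij_linear scalerBr opprD [LHS]addrACA.
apply: mode_derivation => // [|k m b]; first by rewrite /rot !Eij_vac subrr.
rewrite rot_gen /rot !Eij_mode linearB /= nprodBl.
(* The index [m = 0] falls under neither sign, but there the mode vanishes by [mode0]. *)
have mode_if l (c : bool) : (if c then u l else 0) _(m) b
  = (if c && (m < 0) then u l _(m) b else 0) + (if c && (0 < m) then u l _(m) b else 0).
  case: c => /=; last by rewrite nprod0l addr0.
  by case: (ltgtP m 0) => [_|_|->]; rewrite ?addr0 ?add0r ?mode0.
rewrite !mode_if.
rewrite [u k _(m) (_ - _)]linearB /=; exact: sub4_regroup.
Qed.

Lemma nprod1_gen i j : u i _(1) u j = if j == i then vac else 0.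
Proof. by rewrite (gen_bracket i j 1) andbT eq_sym. Qed.

Lemma derivation_vac D : is_derivation D -> D vac = 0.
Proof.
case=> _ _ DM _; have := DM vac vac; rewrite /nop nprod_vacN1 nprod_vac_r nprod_vacN1.
by move/eqP; rewrite -subr_eq0 opprD addrA subrr sub0r oppr_eq0 => /eqP.
Qed.

(** Monomials arise from the generators by translation and normally ordered products, both of which
    derivations respect. *)
Lemma derivation_ext D1 D2 : is_derivation D1 -> is_derivation D2 ->
  (forall i, D1 (u i) = D2 (u i)) -> D1 = D2.
Proof.
move=> D1der D2der D12; have [D1lin D1T D1M _] := D1der; have [D2lin D2T D2M _] := D2der.
have D12gen p : D1 (gen u p) = D2 (gen u p).
  rewrite /gen; elim: p.2 => [|n IHn] /=; first exact: D12.
  by rewrite D1T D2T IHn.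
apply: funext; apply: monomial_ind => [x a b Ha Hb|s].
  by rewrite D1lin D2lin Ha Hb.
elim: s => [|p s IHs] /=; first by rewrite !derivation_vac.
by rewrite D1M D2M D12gen IHs.
Qed.

(* Applies (E - 1)...(E - n), which for large n leaves only the degree 0 part
   of v, a multiple of the vacuum. *)
Fixpoint Edescend (n : nat) v : V :=
  if n is n'.+1 then Edescend n' (Ediag v - n%:R *: v) else v.

Lemma Edescend_linear n : linear (Edescend n).
Proof.
elim: n => [//|n IHn] x a b /=.
rewrite -IHn Ediag_linear; congr (Edescend n _).
by rewrite scalerBr scalerDr opprD addrACA !scalerA [x * _]mulrC.
Qed.

Lemma Edescend_eigen (n d : nat) v : (0 < d <= n)%N -> Ediag v = d%:R *: v ->
  Edescend n v = 0.
Proof.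
move=> dn Ev; elim: n dn => [|n IHn] dn /=; first by lia.
rewrite Ev -scalerBl (linear_mapZ (Edescend_linear n)).
have [->|dn'] := eqVneq d n.+1; first by rewrite subrr scale0r.
by rewrite IHn ?scaler0 //; lia.
Qed.

Lemma Ediag_nmonomial s : Ediag (nmonomial u s) = (size s)%:R *: nmonomial u s.
Proof.
elim: s => [|p s IHs]; first by rewrite /= Ediag_vac scale0r.
have [x ->] := nmonomial_cons p s.
rewrite (linear_mapZ Ediag_linear) Ediag_creation IHs linearZ_LR /=.
by rewrite scalerDr !scalerA mulrSr mulrDl mul1r scalerDl mulrC.
Qed.

Lemma Edescend_vac v : eventually (fun n => exists c : F, Edescend n v = c *: vac).
Proof.
elim/monomial_ind: v => [x a b Ha Hb|s].
  have [n0 H] := eventually_and Ha Hb; exists n0 => n /H[[c1 E1] [c2 E2]].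
  by exists (x * c1 + c2); rewrite Edescend_linear E1 E2 scalerA scalerDl.
exists (size s) => n len; have [->|s0] := eqVneq s [::].
  elim: n {len} => [|n [c IHn]] /=; first by exists 1; rewrite scale1r.
  exists (- n.+1%:R * c); rewrite Ediag_vac sub0r -scaleNr.
  by rewrite (linear_mapZ (Edescend_linear n)) IHn scalerA.
exists 0; rewrite scale0r; apply: (@Edescend_eigen _ (size s)).
  by rewrite lt0n size_eq0 s0.
exact: Ediag_nmonomial.
Qed.

(** * Kernels of the degree operator and of translation *)

Lemma scale_natS_inv (n : nat) v w : n.+1%:R *: v = w -> v = (n.+1%:R)^-1 *: w.
Proof. by move=> <-; rewrite scalerA mulVf ?natS_neq0 // scale1r. Qed.

(** On the kernel of [Ediag], [Edescend n] is multiplication by the nonzero scalar [(-1)^n n!],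
    while its value is a multiple of the vacuum for large [n]. *)
Lemma Ediag_ker v : Ediag v = 0 -> exists c : F, v = c *: vac.
Proof.
have [n [c]] := eventually_ex (Edescend_vac v).
elim: n c v => [|n IHn] c v /=; first by exists c.
move=> Hc Ev; rewrite Ev sub0r in Hc.
have [|x xP] := IHn _ _ Hc.
  by rewrite -scaleNr (linear_mapZ Ediag_linear) Ev scaler0.
exists (n.+1%:R^-1 * - x); rewrite -scalerA scaleNr -xP opprK.
exact: scale_natS_inv.
Qed.

(** The commutator of [transl] with [u i _(n + 1)] yields [u i _(n) w = 0] from
    [u i _(n + 1) w = 0]. Starting at the locality bound, every annihilation mode kills [w], hence
    [Ediag w = 0]. *)
Lemma transl_annihilated w : (forall i (n : nat), u i _(n.+1%:Z) (transl w) = 0) ->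
  exists c : F, w = c *: vac.
Proof.
move=> Hw; apply: Ediag_ker; rewrite /Ediag big1 // => i _.
have [K HK] := nprod_locality (u i) w.
(* Descending induction on [n], with [d] bounding its distance to the locality bound [K]. *)
suff w0 (d n : nat) : (K <= n + d)%N -> u i _(n%:Z) w = 0.
  have [M ->] := eventually_ex (EijE i i w); rewrite /pair_sum big1 // => l _.
  by rewrite (w0 K) ?linear0 ?scaler0 // leq_addl.
elim: d n => [|d IHd] n leK; first by rewrite HK // lez_nat -[n]addn0.
have := transl_nprod (u i) n.+1%:Z w.
rewrite IHd ?addSnnS // linear0 Hw sub0r (_ : n.+1%:Z - 1 = n%:Z); last by lia.
move/eqP; rewrite eq_sym oppr_eq0 -pmulrn -scaler_nat scaler_eq0.
by rewrite (negbTE (natS_neq0 n)) => /eqP.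
Qed.

(** Nonnegative modes kill the vacuum, so [w] is itself a multiple of the vacuum and
    [transl w = 0]. *)
Lemma vac_transl (c : F) w : c *: vac = transl w -> c = 0.
Proof.
move=> cw; have [i n|x xP] := @transl_annihilated w.
  by rewrite -cw linearZ_LR /= nprod_vac_nneg scaler0.
move/eqP: cw; rewrite xP linearZ_LR /= transl_vac scaler0 scaler_eq0.
by rewrite (negbTE vac_neq0) orbF => /eqP.
Qed.

(* The variational derivative of v with respect to u_i, for M large. *)
Definition variation (M : nat) i v : V :=
  \sum_(l < M) ((-1) ^+ l / l.+1%:R : F) *: dpow l (u i _(l.+1%:Z) v).

(** In skew symmetry the term [j = 0] vanishes by [mode0], and every higher divided power of
    [transl] is a translate. *)
Lemma bracket_gen v i : eventually (fun M => v _(0) u i = transl (variation M i v)).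
Proof.
have [M0 H] := nprod_skew (u i) v; exists M0 => M /leqW/H ->.
rewrite big_ord_recl mode0 linear0 scaler0 add0r /variation [RHS]linear_sum -sumrN.
apply: eq_bigr => l _; rewrite [RHS]linearZ_LR /= transl_dpow /bump /= -scaler_nat scalerA.
by rewrite mulfVK ?natS_neq0 // add1n exprS mulN1r scaleNr opprK.
Qed.

(** Integration by parts, [n] times. *)
Lemma creation_mod_transl a w (n : nat) : exists g,
  a _(-1 - n%:Z) w = (-1) ^+ n *: (a _(-1) (dpow n w)) + transl g.
Proof.
elim: n w => [|n IHn] w.
  by exists 0; rewrite linear0 dpow0 expr0 scale1r (_ : -1 - 0%:Z = -1) ?addr0.
have [g gP] := IHn (transl w).
(* The witness solves the Leibniz rule for [transl (a _(-1 - n) w)] for its term with coefficient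
   [n + 1]. *)
exists (n.+1%:R^-1 *: (a _(-1 - n%:Z) w - g)).
have := transl_nprod a (-1 - n%:Z) w.
rewrite gP dpow_transl -scaler_nat linearZ_LR /=.
rewrite (_ : -1 - n%:Z - 1 = -1 - n.+1%:Z); last by lia.
rewrite (_ : -1 - n%:Z = - n.+1%:Z); last by lia.
rewrite mulrNz opprK -pmulrn -scaler_nat addrC => E.
have /scale_natS_inv -> := canRL (addrK _) (esym E).
rewrite translZ translB opprD addrA (addrAC (transl _)) [LHS]scalerBr [LHS]addrC.
congr (_ + _); rewrite (scalerA ((-1) ^+ n)) mulrC scalerA mulrA.
by rewrite mulVf ?natS_neq0 // mul1r exprS mulN1r scaleNr.
Qed.

(** * Elements with vanishing brackets *)

Lemma casimir_Ediag v : (forall i, v _(0) u i = 0) ->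
  exists (c : 'I_N -> F) g, Ediag v = \sum_i c i *: u i + transl g.
Proof.
move=> v0.
have [M H] := eventually_ex (eventually_forall
  (fun i => eventually_and (EijE i i v) (bracket_gen v i))).
(* The translate of the variational derivative is [v _(0) u i = 0], so the variational derivative is
   constant. *)
have /choice[c cP] i : exists c : F, variation M i v = c *: vac.
  apply: transl_annihilated => j n; have [_ <-] := H i.
  by rewrite v0 linear0.
have /choice[g gP] (p : 'I_N * 'I_M) := creation_mod_transl (u p.1)
  (u p.1 _(p.2.+1%:Z) v) p.2.
exists c, (\sum_i \sum_(l < M) (l.+1%:R : F)^-1 *: g (i, l)).
rewrite linear_sum -big_split; apply: eq_bigr => i _ /=.
have [-> _] := H i; rewrite /pair_sum.
have gP' (l : 'I_M) : u i _(-1 - l%:Z) (u i _(l.+1%:Z) v) = _ := gP (i, l).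
under [LHS]eq_bigr => l _ do rewrite gP' /= scalerDr.
rewrite big_split [transl _]linear_sum /=; congr (_ + _); last first.
  by apply: eq_bigr => l _; rewrite translZ.
(* After integration by parts the terms of [Eij i i v] add up to the normally ordered product of
   [u i] with the variational derivative. *)
transitivity (u i _(-1) (variation M i v)).
  rewrite /variation linear_sum; apply: eq_bigr => l _ /=.
  by rewrite scalerA nprodZr mulrC.
by rewrite cP linearZ_LR /= nprod_vac_r.
Qed.

Definition casimir_form v : Prop :=
  exists (c0 : F) (c : 'I_N -> F) g, v = c0 *: vac + \sum_i c i *: u i + transl g.

Lemma casimir_form_lin (x : F) a b :
  casimir_form a -> casimir_form b -> casimir_form (x *: a + b).
Proof.
move=> [a0 [ai [ga ->]]] [b0 [bi [gb ->]]].
exists (x * a0 + b0), (fun i => x * ai i + bi i), (x *: ga + gb).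
rewrite [transl (_ + _)]linearP /= !scalerDr addrACA; congr (_ + _).
rewrite addrACA; congr (_ + _); first by rewrite scalerDl scalerA.
rewrite scaler_sumr -big_split; apply: eq_bigr => i _ /=.
by rewrite scalerDl scalerA.
Qed.

Lemma casimir_form_bracket v b : casimir_form v -> v _(0) b = 0.
Proof.
move=> [c0 [c [g ->]]]; rewrite !nprodDl nprodZl nprod_vac_neq // scaler0 add0r.
rewrite nprod_transl_l mulr0z oppr0 addr0 nprod_suml big1 // => i _.
by rewrite nprodZl mode0 scaler0.
Qed.

Lemma casimir_gens v : (forall i, v _(0) u i = 0) -> casimir_form v.
Proof.
have [n [c]] := eventually_ex (Edescend_vac v).
elim: n c v => [|n IHn] c v /=.
  move=> -> _; exists c, (fun=> 0), 0; rewrite linear0 big1 ?addr0 // => i _.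
  by rewrite scale0r.
move=> Hc v0; have [ci [g Ev]] := casimir_Ediag v0.
have formE : casimir_form (Ediag v) by exists 0, ci, g; rewrite scale0r add0r.
have formN : casimir_form (Ediag v - n.+1%:R *: v).
  apply: (IHn c) => // i; rewrite nprodBl nprodZl v0 scaler0 subr0.
  exact: casimir_form_bracket.
(* Both [Ediag v] and [Ediag v - (n + 1) v] have the required form, the latter by induction, and [v]
   is a combination of them. *)
have -> : v = n.+1%:R^-1 *: (-1 *: (Ediag v - n.+1%:R *: v) + Ediag v) + 0.
  by rewrite addr0; apply: scale_natS_inv; rewrite scaleN1r opprB subrK.
apply: casimir_form_lin; first exact: casimir_form_lin.
by exists 0, (fun=> 0), 0; rewrite linear0 big1 ?scale0r ?addr0 // => i _; rewrite scale0r.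
Qed.

(** * Values of derivations on generators, and the inner ones among them *)

Definition compatible (f : 'I_N -> V) : Prop :=
  forall i j (n : nat), f j _(n%:Z) u i + u j _(n%:Z) f i = 0.

(** The brackets of generators are multiples of the vacuum, which a derivation kills. *)
Lemma derivation_compatible D : is_derivation D -> compatible (D \o u).
Proof.
move=> Dder i j n; have [Dlin _ _ DM] := Dder.
have := DM (u j) (u i) n; rewrite /lbracket -scalerDr gen_bracket.
rewrite (linear_mapZ Dlin) (_ : D (if _ then _ else _) = 0); last first.
  by case: ifP => _; [exact: derivation_vac | exact: linear_map0].
rewrite scaler0 => /esym/eqP; rewrite scaler_eq0 invr_eq0.
by rewrite (negbTE (fact_neq0 n)) => /eqP.
Qed.

Lemma compatible_lin (x : F) f g : compatible f -> compatible g ->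
  compatible (fun i => x *: f i + g i).
Proof.
move=> cf cg i j n; rewrite nprodDl nprodZl linearP /= addrACA -scalerDr.
by rewrite cf cg scaler0 addr0.
Qed.

(* By compatibility, the n-th term of Borcherds' formula for (u_j(-1)g_j)_(0) u_i
   is the n-th term of the degree operator applied to f_i. *)
Lemma bracket_homotopy f g : compatible f -> (forall i, f i = transl (g i)) ->
  forall i, (\sum_j u j _(-1) g j) _(0) u i = f i + Ediag (f i).
Proof.
move=> cf fg i.
have [M [ltM H]] := eventually_ex (eventually_and (eventually_ge 2) (eventually_forall
  (fun j => eventually_and (EijE j j (f i)) (nprod_assoc (u j) (g j) (u i) (-1) 0)))).
have fi : f i = \sum_j if j == i then f j else 0 by rewrite -big_mkcond big_pred1_eq.
rewrite {1}fi /Ediag -big_split nprod_suml; apply: eq_bigr => j _ /=.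
have [-> ->] := H j.
(* The summand [f j] comes from [l = 1], where [u j _(1) u i] is the vacuum for [j = i] and
   [g j _(-2) vac] is [transl (g j)]. *)
have -> : (if j == i then f j else 0) =
    \sum_(l < M) if (j == i) && ((l : nat) == 1%N) then f j else 0.
  rewrite (big_ord_only 1 (fun l => if (j == i) && (l == 1)%N then f j else 0)) ?andbT //.
  by move=> l /negbTE ->; rewrite andbF.
rewrite /pair_sum -big_split; apply: eq_bigr => l _ /=.
have -> : (-1) ^+ l * binz (-1) l = 1.
  by rewrite /binz /= add0n binn mulr1 -exprMn mulrNN mulr1 expr1n.
rewrite mulr1z expr1 mulrN1z opprK [LHS]addrC gen_bracket; congr (_ + _).
  case: ifP => [/andP[_ /eqP ->]|_]; last by rewrite linear0.
  by rewrite fg /transl.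
have -> : u j _(l.+1%:Z) f i = l.+1%:R *: (g j _(l%:Z) u i).
  have /eqP := cf i j l.+1; rewrite addrC addr_eq0 (fg j) nprod_transl_l opprK => /eqP ->.
  by rewrite (_ : l.+1%:Z - 1 = l%:Z) -?pmulrn -?scaler_nat //; lia.
by rewrite nprodZr scalerA mulVf ?natS_neq0 // scale1r add0r.
Qed.

Definition inner_on_gens (f : 'I_N -> V) : Prop :=
  exists v, forall i, v _(0) u i = f i.

Lemma inner_on_gens_lin (x : F) f g : inner_on_gens f -> inner_on_gens g ->
  inner_on_gens (fun i => x *: f i + g i).
Proof.
by move=> [v vP] [w wP]; exists (x *: v + w) => i; rewrite nprodDl nprodZl vP wP.
Qed.

Lemma inner_on_gens_compatible f : inner_on_gens f -> compatible f.
Proof.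
move=> [v vP] i j n; rewrite -!vP.
have := nprod_derivation_is_derivation (nprod0_derivation v).
by move/derivation_compatible; apply.
Qed.

Lemma inner_on_gens_transl f : inner_on_gens f -> forall i, exists g, f i = transl g.
Proof.
move=> [v vP] i; rewrite -vP.
by have [M ->] := eventually_ex (bracket_gen v i); exists (variation M i v).
Qed.

Lemma compatible_inner f : compatible f -> (forall i, exists g, f i = transl g) ->
  inner_on_gens f.
Proof.
move=> cf tf.
have [n fn] := eventually_ex (eventually_forall (fun i => Edescend_vac (f i))).
elim: n f cf tf fn => [|n IHn] f cf tf fn.
  (* Here [f i] is both a multiple of the vacuum and a translate, hence zero. *)
  exists 0 => i; rewrite nprod0l; have [g fg] := tf i; have [c fc] := fn i.
  move: fc; rewrite /= => fc.
  by rewrite fc (@vac_transl c g) ?scale0r // -fc.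
have [g fg] := choice tf.
have innE : inner_on_gens (fun i => f i + Ediag (f i)).
  by exists (\sum_j u j _(-1) g j); exact: bracket_homotopy.
(* Writing [E - (n + 1)] as [(E + 1) - (n + 2)] shows that the next descent step keeps compatibility
   and stays among translates; as [n + 2] is invertible, [f] is recovered from two inner
   families. *)
have fE i : Ediag (f i) - n.+1%:R *: f i = - n.+2%:R *: f i + (f i + Ediag (f i)).
  by rewrite addrA addrC scaleNr -[n.+2%:R]natr1 scalerDl scale1r opprD addrNK.
have innN : inner_on_gens (fun i => Ediag (f i) - n.+1%:R *: f i).
  apply: IHn => [||i]; last exact: fn.
  - rewrite (funext fE); apply: compatible_lin => //.
    exact: inner_on_gens_compatible.
  - move=> i; have [h hP] := inner_on_gens_transl innE i.
    exists (- n.+2%:R *: g i + h).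
    by rewrite fE hP fg [RHS]linearP.
have -> : f = fun i => n.+2%:R^-1 *: (-1 *: (Ediag (f i) - n.+1%:R *: f i)
    + (f i + Ediag (f i))) + 0.
  apply: funext => i; rewrite addr0; apply: scale_natS_inv.
  by rewrite fE scaleN1r opprD scaleNr opprK addrNK.
apply: inner_on_gens_lin; first exact: inner_on_gens_lin.
by exists 0 => i; rewrite nprod0l.
Qed.

(** Compatibility at [n = 0] gives the shape of [D (u i)]. At [n = 1] it makes [(a i j + a j i) vac]
    a translate, which forces skewness. *)
Lemma derivation_gens D : is_derivation D ->
  exists (c : 'I_N -> F) (a : 'I_N -> 'I_N -> F) (g : 'I_N -> V),
    (forall i j, a i j + a j i = 0) /\
    forall i, D (u i) = c i *: vac + \sum_j a i j *: u j + transl (g i).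
Proof.
move=> Dder; have cD := derivation_compatible Dder.
have /choice[c /choice[a /choice[g E]]] i : casimir_form (D (u i)).
  apply: casimir_gens => j.
  by have := cD j i 0; rewrite mode0 addr0.
exists c, a, g; split=> // i j; have := cD j i 1.
have E1 k l : u l _(1) D (u k) = a k l *: vac + transl (u l _(1) g k).
  rewrite E !linearD /= !nprodZr nprod_vac_r0 // scaler0 add0r linear_sum /=.
  rewrite (bigD1 l) //= big1 ?addr0 => [|m /negbTE lm].
    rewrite nprodZr nprod1_gen eqxx; congr (_ + _).
    have := transl_nprod (u l) 1 (g k).
    by rewrite mode0 mul0rz subr0.
  by rewrite nprodZr nprod1_gen lm scaler0.
have [M Eg] := eventually_ex (bracket_gen (g i) j).
rewrite /= E1 E !nprodDl nprodZl nprod_vac_neq // scaler0 add0r nprod_suml.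
rewrite (bigD1 j) //= big1 ?addr0 => [|m /negbTE jm]; last first.
  by rewrite nprodZl nprod1_gen eq_sym jm scaler0.
rewrite nprodZl nprod1_gen eqxx nprod_transl_l mulr1z Eg -linearN addrACA -linearD.
rewrite -scalerDl => /eqP; rewrite addr_eq0 -linearN => /eqP.
exact: vac_transl.
Qed.

(** * The basis of Casimir classes *)

Lemma transl_casimir_form g : casimir_form (transl g).
Proof. by exists 0, (fun=> 0), g; rewrite scale0r big1 ?add0r // => i _; rewrite scale0r. Qed.

(** By [mode0], [u j _(1)] commutes with [transl], so it reads off the coefficient of [u j] modulo
    translates. *)
Lemma mode1_vac_transl j (x : F) a w : u j _(1) a = x *: vac -> a = transl w -> x = 0.
Proof.
move=> ja aw; apply: (@vac_transl x (u j _(1) w)); rewrite -ja aw.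
by rewrite transl_nprod mode0 mul0rz subr0.
Qed.

Lemma casimir_basis : basis_of_quotient (casimir_rep V) (transl_image V) (vac_and_gens u).
Proof.
apply: basis_of_quotient_fin.
- move=> _ [g _ <-] b; rewrite lbracket0.
  exact/casimir_form_bracket/transl_casimir_form.
- by case=> [i|] b; rewrite lbracket0 /= ?mode0 ?nprod_vac_neq.
- move=> c [w _ cw].
  have split_sum : \sum_o c o *: vac_and_gens u o = c None *: vac + \sum_i c (Some i) *: u i.
    rewrite (bigD1 None) //=; congr (_ + _).
    rewrite (reindex_omap Some id) /=; last by case.
    by apply: eq_bigl => i; rewrite eqxx.
  have cSome i : c (Some i) = 0.
    apply: (@mode1_vac_transl i _ _ w); last exact: (esym cw).
    rewrite split_sum linearD /= nprodZr nprod_vac_r0 // scaler0 add0r linear_sum /=.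
    rewrite (bigD1 i) //= big1 ?addr0 => [|j /negbTE ij].
      by rewrite nprodZr nprod1_gen eqxx.
    by rewrite nprodZr nprod1_gen ij scaler0.
  case=> [i|]; first exact: cSome.
  apply: (@vac_transl _ w); rewrite cw split_sum big1 ?addr0 // => i _.
  by rewrite cSome scale0r.
- move=> v v0; have [|c0 [c [g vE]]] := @casimir_gens v.
    by move=> i; rewrite -lbracket0; exact: v0.
  exists (fun o => if o is Some i then c i else c0); exists g => //.
  rewrite (bigD1 None) //= (reindex_omap Some id) /=; last by case.
  rewrite (eq_bigl xpredT) => [|i]; last by rewrite /= eqxx.
  by rewrite vE [X in _ = X - _]addrC addrK.
Qed.

(** * Linear combinations of derivations, and the outer representatives *)

Lemma derivation_lin (x : F) D1 D2 : is_derivation D1 -> is_derivation D2 ->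
  is_derivation (x *: D1 + D2).
Proof.
move=> [L1 T1 M1 B1] [L2 T2 M2 B2]; split.
- move=> y a b; rewrite !fctE L1 L2 !scalerDr addrACA; congr (_ + _).
  by rewrite !scalerA mulrC.
- by move=> a; rewrite !fctE T1 T2 [RHS]linearP.
- move=> a b; rewrite !fctE M1 M2 /nop nprodDl nprodZl linearP /= scalerDr.
  by rewrite addrACA.
- move=> a b n; rewrite !fctE B1 B2 /lbracket nprodDl nprodZl nprod_linear_r !scalerDr.
  by rewrite !scalerA ![x * _]mulrC addrACA.
Qed.

Lemma derivation0 : is_derivation (0 : V -> V).
Proof.
split=> [x a b|a|a b|a b n]; rewrite ?fctE /=.
- by rewrite scaler0 addr0.
- by rewrite [RHS]linear0.
- by rewrite /nop nprod0l linear0 addr0.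
- by rewrite /lbracket nprod0l !linear0 addr0.
Qed.

Lemma derivation_sum (I : finType) (c : I -> F) (e : I -> V -> V) :
  (forall x, is_derivation (e x)) -> is_derivation (\sum_x c x *: e x).
Proof.
move=> He; elim/big_ind: _ => [|D1 D2 H1 H2|i _].
- exact: derivation0.
- by rewrite -[D1]scale1r; exact: derivation_lin.
- by rewrite -[_ *: _]addr0; apply: derivation_lin => //; exact: derivation0.
Qed.

Lemma partial_exists i : is_partial u i (nprod (u i) 1).
Proof.
split=> [|j]; last exact: nprod1_gen.
by apply/nprod_derivation_is_derivation/nprod1_derivation => b; exact: mode0.
Qed.

Lemma partial_unique i : exists! D, is_partial u i D.
Proof.
exists (nprod (u i) 1); split; first exact: partial_exists.
move=> D [Dder Dgen]; have [Pder Pgen] := partial_exists i.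
by apply: derivation_ext => // j; rewrite Dgen Pgen.
Qed.

Lemma rotation_gen i j D : (i < j)%N -> is_rotation u i j D -> forall k,
  D (u k) = (if j == k then u i else 0) - (if i == k then u j else 0).
Proof.
move=> ltij [_ Dj Di D0] k; have neij : i != j by rewrite -val_eqE ltn_eqF.
have [<-|nejk] := eqVneq j k; first by rewrite (negbTE neij) subr0.
have [<-|neik] := eqVneq i k; first by rewrite sub0r.
by rewrite subr0 D0 // eq_sym.
Qed.

Lemma rotation_exists i j : (i < j)%N -> is_rotation u i j (rot i j).
Proof.
move=> ltij; have neij : i != j by rewrite -val_eqE ltn_eqF.
split=> [|||l li lj]; rewrite ?rot_gen.
- exact/nprod_derivation_is_derivation/rot_derivation.
- by rewrite eqxx (negbTE neij) subr0.
- by rewrite eqxx eq_sym (negbTE neij) sub0r.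
- by rewrite ![_ == l]eq_sym (negbTE li) (negbTE lj) subr0.
Qed.

Lemma rotation_unique i j : (i < j)%N -> exists! D, is_rotation u i j D.
Proof.
move=> ltij; have R := rotation_exists ltij.
exists (rot i j); split=> // D RD; have [Dder _ _ _] := RD; have [Rder _ _ _] := R.
by apply: derivation_ext => // k; rewrite (rotation_gen ltij RD) (rotation_gen ltij R).
Qed.

(** Each [j] other than [k] shares exactly one ordered pair with [k], and skewness absorbs the sign
    of its term. The diagonal entry [a k k] is zero because 2 is invertible. *)
Lemma skew_pair_sum (a : 'I_N -> 'I_N -> F) (w : 'I_N -> V) k :
  (forall i j, a i j + a j i = 0) ->
  \sum_(p : {p : 'I_N * 'I_N | (p.1 < p.2)%N}) a (val p).2 (val p).1 *:
    ((if (val p).2 == k then w (val p).1 else 0)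
     - (if (val p).1 == k then w (val p).2 else 0)) = \sum_j a k j *: w j.
Proof.
move=> aN.
have akk : a k k = 0.
  have /eqP := aN k k; rewrite -mulr2n -mulr_natr mulf_eq0.
  by rewrite (negbTE (natS_neq0 1)) orbF => /eqP.
pose f (p : 'I_N * 'I_N) : V := (if p.2 == k then a k p.1 *: w p.1 else 0)
  + (if p.1 == k then a k p.2 *: w p.2 else 0).
transitivity (\sum_(p : {p : 'I_N * 'I_N | (p.1 < p.2)%N}) f (val p)).
  apply: eq_bigr => p _; rewrite /f scalerBr.
  case: eqP => [->|_]; case: eqP => [->|_]; rewrite ?scaler0 ?subr0 ?addr0 ?sub0r ?add0r //.
    by rewrite akk scale0r subr0 addr0.
  by rewrite -scaleNr; congr (_ *: _); apply/esym/eqP; rewrite -addr_eq0 aN.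
rewrite -(big_sub (fun p : 'I_N * 'I_N => (p.1 < p.2)%N) f).
rewrite /f big_split /=.
rewrite -(pair_big_dep xpredT (fun i j : 'I_N => (i < j)%N)
  (fun i j => if j == k then a k i *: w i else 0)) /=.
rewrite -(pair_big_dep xpredT (fun i j : 'I_N => (i < j)%N)
  (fun i j => if i == k then a k j *: w j else 0)) /=.
rewrite [X in _ + X](exchange_big_dep xpredT) //= -big_split /=.
apply: eq_bigr => j _.
have only_k (Q : pred 'I_N) (x : V) :
    \sum_(i | Q i) (if i == k then x else 0) = if Q k then x else 0.
  rewrite big_mkcond (bigD1 k) //= eqxx big1 ?addr0 // => i /negbTE ->.
  by rewrite if_same.
rewrite !only_k; case: (ltngtP j k) => [_|_|/val_inj ->]; rewrite ?addr0 ?add0r //.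
by rewrite akk scale0r.
Qed.

(** * The basis of derivations modulo inner ones *)

Lemma outer_basis P R : (forall i, is_partial u i (P i)) ->
  (forall i j, (i < j)%N -> is_rotation u i j (R i j)) ->
  basis_of_quotient (Der V) (Inder V) (outer_family P R).
Proof.
move=> PP RR.
have outer_der x : is_derivation (outer_family P R x).
  case: x => [i|p] /=; first by have [] := PP i.
  by have [] := RR _ _ (valP p).
have outer_gen (c : _ -> F) k : (\sum_x c x *: outer_family P R x) (u k) = c (inl k) *: vac
    + \sum_(p : {p : 'I_N * 'I_N | (p.1 < p.2)%N}) c (inr p) *:
        ((if (val p).2 == k then u (val p).1 else 0)
         - (if (val p).1 == k then u (val p).2 else 0)).
  rewrite fct_sumE big_sumType /=; congr (_ + _).
    rewrite (bigD1 k) //= big1 ?addr0 => [|i /negbTE ik]; rewrite fctE.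
      by have [_ ->] := PP k; rewrite eqxx.
    by have [_ ->] := PP i; rewrite eq_sym ik scaler0.
  by apply: eq_bigr => p _; rewrite fctE (rotation_gen (valP p) (RR _ _ (valP p))).
apply: basis_of_quotient_fin => //.
- move=> D [v Dv] /=; have -> : D = nprod v 0 by apply: funext => b; rewrite Dv lbracket0.
  exact/nprod_derivation_is_derivation/nprod0_derivation.
- move=> c [v cv].
  (* An inner derivation sends every generator to a translate. *)
  have {}cv k : exists g, c (inl k) *: vac
    + \sum_(p : {p : 'I_N * 'I_N | (p.1 < p.2)%N}) c (inr p) *:
        ((if (val p).2 == k then u (val p).1 else 0)
         - (if (val p).1 == k then u (val p).2 else 0)) = transl g.
    have [M E] := eventually_ex (bracket_gen v k); exists (variation M k v).
    by rewrite -outer_gen cv lbracket0 E.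
  (* On [u] at the larger index of [p], the coefficient of [u] at the smaller one is [c (inr p)];
     any other contributing pair would be [p] itself or [p] reversed, which is not increasing. *)
  have c_inr p : c (inr p) = 0.
    have [g gP] := cv (val p).2; apply: (@mode1_vac_transl (val p).1 _ _ g _ gP).
    rewrite linearD /= nprodZr nprod_vac_r0 // scaler0 add0r linear_sum /=.
    rewrite (bigD1 p) //= big1 ?addr0 => [|q qp]; rewrite nprodZr linearB /=.
      have neq : (val p).1 != (val p).2 by rewrite -val_eqE ltn_eqF // (valP p).
      by rewrite eqxx (negbTE neq) linear0 subr0 nprod1_gen eqxx.
    have mode_if (b : bool) i j :
        u i _(1) (if b then u j else 0) = if b && (j == i) then vac else 0.
      by case: b; rewrite ?nprod1_gen ?linear0.
    rewrite !mode_if //.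
    have /negbTE -> : ~~ (((val q).2 == (val p).2) && ((val q).1 == (val p).1)).
      apply: contra qp => /andP[/eqP q2 /eqP q1]; apply/eqP/val_inj.
      by rewrite [LHS]surjective_pairing [RHS]surjective_pairing q1 q2.
    have /negbTE -> : ~~ (((val q).1 == (val p).2) && ((val q).2 == (val p).1)).
      apply/negP => /andP[/eqP q1 /eqP q2].
      by have := valP q; rewrite /= q1 q2 ltnNge ltnW // (valP p).
    by rewrite subr0 scaler0.
  case=> [k|//]; have [g gP] := cv k.
  apply: (@vac_transl _ g); rewrite -gP big1 ?addr0 // => p _.
  by rewrite c_inr scale0r.
- move=> D Dder; have [c [a [g [aN Dgen]]]] := derivation_gens Dder.
  (* For [i < j] the rotation sends [u j] to [u i], so its coefficient is the entry [a j i]. *)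
  pose d (x : 'I_N + {p : 'I_N * 'I_N | (p.1 < p.2)%N}) :=
    match x with inl i => c i | inr p => a (val p).2 (val p).1 end.
  exists d; pose D' := D - \sum_x d x *: outer_family P R x.
  have D'der : is_derivation D'.
    rewrite /D' addrC -scaleN1r; apply: derivation_lin => //.
    exact: derivation_sum.
  have D'gen k : D' (u k) = transl (g k).
    rewrite /D' !fctE outer_gen Dgen [X in _ + X](_ : _ = - (c k *: vac + \sum_j a k j *: u j)).
      by rewrite addrC addKr.
    congr (- (_ + _)); rewrite /d.
    exact: skew_pair_sum.
  have [|k|v vP] := @compatible_inner (fun k => D' (u k)).
  - exact: derivation_compatible.
  - by exists (g k).
  exists v => b; rewrite lbracket0 -/D'.
  suff -> : D' = nprod v 0 by [].
  apply: derivation_ext => //.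
  exact/nprod_derivation_is_derivation/nprod0_derivation.
Qed.

End FreeBosons.

Theorem mainTheorem11 (F : fieldType) (charF0 : [pchar F] =i pred0)
    (N : nat) (N_gt0 : (0 < N)%N)
    (B : vertexAlgType F) (u : 'I_N -> B) (uB : is_free_bosons u) :
  (dim_of_quotient (casimir_rep B) (transl_image B) N.+1 /\
   basis_of_quotient (casimir_rep B) (transl_image B) (vac_and_gens u)) /\
  [/\ dim_of_quotient (Der B) (Inder B) 'C(N.+1, 2),
      forall i : 'I_N, exists! D : B -> B, is_partial u i D,
      forall i j : 'I_N, (i < j)%N -> exists! D : B -> B, is_rotation u i j D
    & forall (P : 'I_N -> B -> B) (R : 'I_N -> 'I_N -> B -> B),
        (forall i, is_partial u i (P i)) ->
        (forall i j : 'I_N, (i < j)%N -> is_rotation u i j (R i j)) ->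
        basis_of_quotient (Der B) (Inder B) (outer_family P R)].
Proof.
have cas_basis := casimir_basis charF0 uB.
split; [split=> // | split].
- rewrite -[N]card_ord -card_option; exact: (dim_of_quotient_fin cas_basis).
(* There are [N] partial derivatives and ['C(N, 2)] rotations; Pascal's rule adds them. *)
- have -> : 'C(N.+1, 2) = #|{: 'I_N + {p : 'I_N * 'I_N | (p.1 < p.2)%N}}|.
    by rewrite card_sum card_ord card_ltn_pairs binS bin1 addnC.
  apply: (dim_of_quotient_fin (outer_basis charF0 uB
    (P := fun i => nprod (u i) 1) (R := rot u) _ _)).
    exact: (partial_exists charF0 uB).
  exact: (rotation_exists charF0 uB).
- exact: (partial_unique charF0 uB).
- exact: (rotation_unique charF0 uB).
- by move=> P R PP RR; exact: (outer_basis charF0 uB PP RR).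
Qed.
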